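(* Let $a\ge 1$ be an integer, and let $X_0\ge 0$ and $N\ge 1$ be integer-valued random variables such that $\mathbb{E}X_0<\infty$, $X_0$ is not almost surely constant, $\mathbb{P}(N>1)>0$ and $\mathbb{E}N<\infty$. Let $(X_n)_{n\ge 0}$ be the associated Derrida--Retaux sequence with random number of terms, let $Q$ be its free energy, and let $F_0(s)=\mathbb{E}(s^{X_0})$. Put $$D_0(s,m)=(m-1)\,s\,F_0'(s)-a\,F_0(s).$$ Then: 1) If $D_0\big((\mathbb{E}N)^{1/a},\,\mathbb{E}N\big)>0$, then $Q>0$. 2) Suppose that there is a real number $M$ with $\mathbb{P}(N\le M)=1$. If $D_0\big(1+\tfrac{M-1}{a},\,M\big)<0$, then $Q=0$.
   Context: The Derrida--Retaux sequence with random number of terms, with parameters $a$, $X_0$, $N$, is the sequence of (laws of) non-negative integer random variables defined by $$X_{n+1}\overset{d}{=}\big(X_n^{(1)}+X_n^{(2)}+\dots+X_n^{(N_{n+1})}-a\big)^{+},\qquad n\ge 0,$$ where $x^+=\max(x,0)$, $X_n^{(1)},X_n^{(2)},\dots$ are independent copies of $X_n$, and $N_{n+1}$ has the law of $N$ and is independent of $(X_n^{(j)})_{j\ge1}$. The free energy is $$Q=\lim_{n\to\infty}\frac{\mathbb{E}(X_n)}{(\mathbb{E}N)^n}.$$ This limit exists, since $\mathbb{E}(X_n)/(\mathbb{E}N)^n$ is non-increasing in $n$ and non-negative. The derivative is $F_0'(s)=\mathbb{E}(X_0 s^{X_0-1})$. Each inequality on $D_0(s,m)$ presupposes that $F_0(s)$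 and $F_0'(s)$ are finite at the point $s$ in question, so that $D_0(s,m)$ is a well-defined real number. *)

(* Defs.v *)
From HB Require Import structures.
From mathcomp Require Import all_boot all_order all_algebra finmap.
From mathcomp Require Import all_classical all_reals all_analysis.

Set Implicit Arguments.
Unset Strict Implicit.
Unset Printing Implicit Defensive.

Import Order.TTheory GRing.Theory Num.Theory.
Import numFieldNormedType.Exports.

Local Open Scope classical_set_scope.
Local Open Scope ring_scope.

Definition mutually_independent (R : realType) (d : measure_display)
    (T : measurableType d) (P : probability T R) (I : choiceType)
    (Z : I -> {RV P >-> nat}) : Prop :=
  forall (J : {fset I}) (A : I -> set nat),
    P (\bigcap_(i in [set` J]) (Z i @^-1` A i)) =
    (\prod_(i <- J) P (Z i @^-1` A i))%E.

(* X^(1), X^(2), ... are Y 0, Y 1, ...; requiring the whole family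
   (N', Y 0, Y 1, ...) to be mutually independent says both that the Y j are
   independent and that N' is independent of them.  The subtraction of [nat]
   is truncated, so it is the positive part. *)
Definition derrida_retaux_step (R : realType) (a : nat)
    (dN : measure_display) (TN : measurableType dN) (PN : probability TN R)
    (N : {RV PN >-> nat})
    (d : measure_display) (T : measurableType d) (P : probability T R)
    (X : {RV P >-> nat})
    (d1 : measure_display) (T1 : measurableType d1) (P1 : probability T1 R)
    (X1 : {RV P1 >-> nat}) : Prop :=
  exists (d' : measure_display) (T' : measurableType d')
         (P' : probability T' R)
         (N' : {RV P' >-> nat}) (Y : nat -> {RV P' >-> nat}),
    [/\ forall A : set nat, distribution P' N' A = distribution PN N A,
        forall (j : nat) (A : set nat),
          distribution P' (Y j) A = distribution P X A,
        mutually_independent (oapp Y N') &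
        forall A : set nat,
          distribution P1 X1 A =
          pushforward P' (fun w => ((\sum_(j < N' w) Y j w) - a)%N) A].

(* Only the laws of the X n matter, so each of them lives on its own
   probability space. *)
Definition derrida_retaux (R : realType) (a : nat)
    (dN : measure_display) (TN : measurableType dN) (PN : probability TN R)
    (N : {RV PN >-> nat})
    (d : nat -> measure_display) (T : forall n, measurableType (d n))
    (P : forall n, probability (T n) R)
    (X : forall n, {RV (P n) >-> nat}) : Prop :=
  forall n, derrida_retaux_step a N (X n) (X n.+1).

Section NatRV.
Context (R : realType) (d : measure_display) (T : measurableType d).
Context (P : probability T R) (X : {RV P >-> nat}).

Definition meane : \bar R := 'E_P[fun w => (X w)%:R].

Definition mean : R := fine meane.

Definition pgf (s : R) : \bar R := 'E_P[fun w => s ^+ X w].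

(* When X w = 0 the truncated exponent is harmless, since the term is 0. *)
Definition dpgf (s : R) : \bar R := 'E_P[fun w => (X w)%:R * s ^+ (X w).-1].

Definition pgf_finite (s : R) : Prop :=
  pgf s \is a fin_num /\ dpgf s \is a fin_num.

(* The value is meaningful under [pgf_finite s]. *)
Definition D0 (a : nat) (s m : R) : R :=
  (m - 1) * s * fine (dpgf s) - a%:R * fine (pgf s).

End NatRV.

(* If N and X 0 have finite means, so has every X n, and for a
   Derrida-Retaux sequence the ratios are non-increasing and non-negative, so
   that the limit exists. *)
Definition free_energy (R : realType)
    (dN : measure_display) (TN : measurableType dN) (PN : probability TN R)
    (N : {RV PN >-> nat})
    (d : nat -> measure_display) (T : forall n, measurableType (d n))
    (P : forall n, probability (T n) R)
    (X : forall n, {RV (P n) >-> nat}) : R :=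
  limn (fun n => mean (X n) / mean N ^+ n).

(* Main.v *)
Require Import Defs.
From HB Require Import structures.
From mathcomp Require Import all_boot all_order all_algebra finmap.
From mathcomp Require Import all_classical all_reals all_analysis.
From mathcomp Require Import measurable_realfun ring lra zify.

Import Order.TTheory GRing.Theory Num.Theory.
Import numFieldNormedType.Exports.

Set Implicit Arguments.
Unset Strict Implicit.
Unset Printing Implicit Defensive.

Local Open Scope classical_set_scope.
Local Open Scope ring_scope.

(** Write [S] for the sum of [N] independent copies of [X n], so that [X n.+1]
    is the positive part of [S - a], let [m] be the mean of [N], and let
    [D_n (s, m) = E (((m - 1) X_n - a) s ^ X_n)].

    Where the mean sits decides the free energy: [E X_(n+1)] lies between
    [m E X_n - a] and [m E X_n], hence [(E X_n - a / (m - 1)) / m ^ n] is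
    non-decreasing and [E X_n / m ^ n] non-increasing. So [Q > 0] as soon as
    some [E X_n] exceeds [a / (m - 1)] ([free_energy_gt0]), and [Q = 0] if the
    means stay bounded ([free_energy_eq0]).

    The link with [D_n] is a comparison of the function
    [phi x = ((m - 1) x - a) s ^ x] at [(S - a)^+] with
    [h S = s ^ -a ((m - 1) S - m a) s ^ S]. They agree if [a <= S]; if [S < a]
    the sign of [phi 0 - h S] is that of [a + (m - 1) y - a s ^ y] with
    [y = a - S]. This is non-negative if [1 <= s] and [s ^ a <= m], by
    convexity of [y |-> s ^ y], and non-positive at [s = 1 + (m - 1) / a], by
    the inequality of Bernoulli. Conditioning on [N] and writing [F] for the
    generating function of [X n] at [s], we get
    [E h(S) = s ^ -a E (N F ^ (N - 1) D_n + a (N - m) F ^ N)]. In the first case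
    the last term is non-negative because [F >= 1] makes [N] and [F ^ N]
    positively correlated, so [D_(n+1) >= (m / s ^ a) D_n] as long as
    [D_n >= 0] ([drift_lower]). In the second case, with an almost sure bound
    [M] of [N] in the place of [m], it is non-positive and [D_(n+1) <= 0]
    follows from [D_n <= 0] ([drift_upper]).

    If [D_n <= 0] for all [n], then [E X_n <= a / (M - 1)], because [s ^ x] is
    increasing ([mean_le_of_pgf]); this is the second claim.

    For the first claim, [D_0 > 0] at [m ^ (1/a)] persists at some smaller [s]
    ([gt_at_smaller_base]), where [m / s ^ a > 1]; thus [D_n] at [s] grows
    geometrically. Suppose that nevertheless [E X_n <= a / (m - 1)] for all [n].
    A value of generation [n] that well exceeds [k a] still makes its successor
    of generation [n + k] large, and this successor is built from about [m ^ k]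
    individuals that may have it; as the means are bounded this forces [P (X_n >= x) <= C t ^ -x] uniformly in [n],
    for every [t < m ^ (1/a)] ([tail_uniform]). With [s < t] the moments
    [E (X_n s ^ X_n)], hence the [D_n], are finite and bounded: a
    contradiction.

    All expectations are taken as integrals of non-negative functions over the
    laws on [nat], in the extended reals, and signed quantities such as [D_n]
    are formed only after their two parts are known to be finite. *)

(** * Integration over the natural numbers *)

(** The sum of [N] terms is the composition of the sum of [k] terms with the
    random index [k = N]; countably many values of the index keep it
    measurable. *)
Lemma measurable_nat_comp d d' (T : measurableType d) (U : measurableType d')
    (Z : T -> nat) (h : nat -> T -> U) :
  measurable_fun setT Z -> (forall k, measurable_fun setT (h k)) ->
  measurable_fun setT (fun w => h (Z w) w).
Proof.
move=> mZ mh _ A mA; rewrite setTI.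
have -> : (fun w => h (Z w) w) @^-1` A =
    \bigcup_k (Z @^-1` [set k] `&` h k @^-1` A).
  apply/seteqP; split => [w hw|w [k _ [/= <-]]] //.
  by exists (Z w).
apply: bigcupT_measurable => k; apply: measurableI.
- by rewrite -[X in measurable X]setTI; exact: mZ.
- by rewrite -[X in measurable X]setTI; exact: mh.
Qed.

(** Conditioning on the value of a discrete variable. *)
Lemma ge0_integral_fibers (R : realType) d (T : measurableType d)
    (mu : {measure set T -> \bar R}) (Z : T -> nat) (B : set T) (f : T -> \bar R) :
  measurable_fun setT Z -> measurable B -> measurable_fun setT f ->
  (forall w, 0 <= f w)%E ->
  (\int[mu]_(w in B) f w =
   \sum_(0 <= k <oo) \int[mu]_(w in B `&` Z @^-1` [set k]) f w)%E.
Proof.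
move=> mZ mB mf f0.
have BE : B = \bigcup_k (B `&` Z @^-1` [set k]).
  by apply/seteqP; split => [w Bw|w [k _ []]] //; exists (Z w).
rewrite [in LHS]BE ge0_integral_bigcup //.
- move=> k; apply: measurableI => //.
  by rewrite -[X in measurable X]setTI; exact: mZ.
- exact: measurable_funTS.
- by apply/trivIsetP => i j _ _ /eqP ij; apply/seteqP; split => // w /=
     [[_ Zi] [_ Zj]]; apply: ij; rewrite -Zi -Zj.
Qed.

Lemma integral_natE (R : realType) (mu : {measure set nat -> \bar R})
    (f : nat -> \bar R) : (forall x, 0 <= f x)%E ->
  (\int[mu]_x f x = \sum_(0 <= k <oo) (f k * mu [set k]))%E.
Proof.
move=> f0; rewrite (@ge0_integral_fibers _ _ _ mu id setT f) //.
apply: eq_eseriesr => k _; rewrite setTI preimage_id.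
rewrite (eq_integral (cst (f k))) ?integral_cst // => x.
by rewrite inE /= => ->.
Qed.

(** * Sums of independent copies *)

Section IteratedSum.
Context (R : realType).
Implicit Types (mu : {measure set nat -> \bar R}) (g : nat -> \bar R).

(** [E (g (x + Y_1 + ... + Y_k))] for independent [Y_j] of law [mu], as an
    iterated integral. The starting point [x] is what lets the recursion
    integrate out one summand at a time. *)
Fixpoint sum_integral mu k g (x : nat) : \bar R :=
  if k is k'.+1 then (\int[mu]_y sum_integral mu k' g (x + y)%N)%E else g x.

Lemma sum_integral_ge0 mu k g x :
  (forall x, 0 <= g x)%E -> (0 <= sum_integral mu k g x)%E.
Proof. by move=> g0; elim: k x => [|k IHk] x //=; apply: integral_ge0. Qed.

(** Independence is known only through the probabilities of cylinders, so it is
    a cylinder [C] on the coordinates that the sum does not involve that is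
    carried through the induction: splitting along the value of [Y i] turns
    [C] into a smaller cylinder and moves this value into [x]. *)
Lemma integral_random_sum_cylinder d (T : measurableType d) (P : probability T R)
    (N : {RV P >-> nat}) (Y : nat -> {RV P >-> nat}) mu g :
  (forall j A, distribution P (Y j) A = mu A) ->
  mutually_independent (oapp Y N) -> (forall x, 0 <= g x)%E ->
  forall i (J : {fset option nat}) (A : option nat -> set nat) x,
  (forall j, Some j \in J -> (i <= j)%N) ->
  let C := \bigcap_(o in [set` J]) (oapp Y N o @^-1` A o) in
  (\int[P]_(w in C) g (x + \sum_(j < i) Y j w)%N = P C * sum_integral mu i g x)%E.
Proof.
move=> lawY indep g0.
have mcyl (J : {fset option nat}) (A : option nat -> set nat) :
    measurable (\bigcap_(o in [set` J]) (oapp Y N o @^-1` A o)).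
  apply: fin_bigcap_measurable => [|o _]; first exact: finite_fset.
  by rewrite -[X in measurable X]setTI; exact: measurable_funP.
have mgY i x : measurable_fun setT (fun w => g (x + \sum_(j < i) Y j w)%N).
  elim: i x => [|i IHi] x.
    by under eq_fun do rewrite big_ord0; exact: measurable_cst.
  under eq_fun do rewrite big_ord_recr /= [(_ + Y i _)%N]addnC addnA.
  exact: (@measurable_nat_comp _ _ _ _ (Y i)
    (fun y w => g (x + y + \sum_(j < i) Y j w)%N)).
elim=> [|i IHi] J A x iJ C.
  under eq_integral do rewrite big_ord0 addn0.
  rewrite (@integral_cst _ _ _ P C _ (g x)); last exact: mcyl.
  by rewrite /= muleC.
rewrite (@ge0_integral_fibers _ _ _ P (Y i)) //; last exact: mcyl.
rewrite [sum_integral _ i.+1 _ _]/=.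
rewrite integral_natE; last by move=> y; exact: sum_integral_ge0.
have PCfin : P C = (fine (P C))%:E by rewrite fineK ?fin_num_measure//; exact: mcyl.
rewrite PCfin -nneseriesZl; last first.
  by move=> k _; rewrite mule_ge0 // sum_integral_ge0.
apply: eq_eseriesr => y _; rewrite -PCfin.
pose A' o := if o == Some i then [set y] else A o.
have iNJ : Some i \notin J by apply/negP => /iJ; rewrite ltnn.
have C'E : C `&` Y i @^-1` [set y] =
    \bigcap_(o in [set` (Some i |` J)%fset]) (oapp Y N o @^-1` A' o).
  rewrite set_fsetU1 bigcap_setU1 /A' eqxx setIC; congr (_ `&` _).
  apply: eq_bigcapr => o /= oJ; case: eqP => // oi.
  by rewrite -oi oJ in iNJ.
have PC' : P (C `&` Y i @^-1` [set y]) = (mu [set y] * P C)%E.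
  rewrite C'E indep big_fsetU1 //= {1}/A' eqxx -(lawY i) /=; congr (_ * _)%E.
  rewrite indep; apply: eq_big_seq => o oJ; rewrite /A'; case: eqP => // oi.
  by rewrite -oi oJ in iNJ.
rewrite (eq_integral (fun w => g (x + y + \sum_(j < i) Y j w)%N)); last first.
  by move=> w /set_mem [_ /= <-]; rewrite big_ord_recr /= addnAC addnA.
rewrite C'E IHi -?C'E ?PC'; first by rewrite muleAC [RHS]muleC [X in (X * _)%E = _]muleC.
by move=> j; rewrite !inE => /orP[/eqP[<-]//|/iJ /ltnW].
Qed.


Lemma random_sum_measurable d (T : measurableType d) (N : T -> nat)
    (Y : nat -> T -> nat) : measurable_fun setT N ->
  (forall j, measurable_fun setT (Y j)) ->
  measurable_fun setT (fun w => \sum_(j < N w) Y j w)%N.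
Proof.
move=> mN mY; apply: (@measurable_nat_comp _ _ _ _ N
  (fun k w => \sum_(j < k) Y j w)%N) => //; elim=> [|k IHk].
  by under eq_fun do rewrite big_ord0; exact: measurable_cst.
under eq_fun do rewrite big_ord_recr /= addnC.
apply: (@measurable_nat_comp _ _ _ _ (Y k)
  (fun y w => y + \sum_(j < k) Y j w)%N) => // y.
exact: (@measurableT_comp _ _ _ _ _ _ (addn y)).
Qed.

Lemma integral_random_sum d (T : measurableType d) (P : probability T R)
    (N : {RV P >-> nat}) (Y : nat -> {RV P >-> nat}) mu g :
  (forall j A, distribution P (Y j) A = mu A) ->
  mutually_independent (oapp Y N) -> (forall x, 0 <= g x)%E ->
  (\int[P]_w g (\sum_(j < N w) Y j w)%N =
   \int[distribution P N]_k sum_integral mu k g 0)%E.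
Proof.
move=> lawY indep g0.
rewrite (@ge0_integral_fibers _ _ _ P N) //; last first.
  suff: measurable_fun setT (fun w => \sum_(j < N w) Y j w)%N.
    by move=> mS; exact: (@measurableT_comp _ _ _ _ _ _ g).
  exact: (@random_sum_measurable _ _ N (fun j => Y j)).
rewrite integral_natE; last by move=> k; exact: sum_integral_ge0.
apply: eq_eseriesr => k _; rewrite setTI.
have E : N @^-1` [set k] =
    \bigcap_(o in [set` [fset None]%fset]) (oapp Y N o @^-1` [set k]).
  by rewrite set_fset1 bigcap_set1.
rewrite (eq_integral (fun w => g (0 + \sum_(j < k) Y j w)%N)); last first.
  by move=> w /set_mem /= ->; rewrite add0n.
rewrite {1}E.
rewrite (@integral_random_sum_cylinder _ _ _ _ _ mu _ _ _ _ k
  [fset None]%fset (fun=> [set k])) //.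
  by rewrite -E muleC.
by move=> j; rewrite inE.
Qed.

End IteratedSum.

(** * Moments and tails *)

Section NatIntegral.
Context (R : realType).
Implicit Types (mu nu sigma : {measure set nat -> \bar R}) (f g : nat -> R).

Lemma le_nat_integral mu f g : (forall x, 0 <= f x) ->
  (forall x, f x <= g x) -> (\int[mu]_x (f x)%:E <= \int[mu]_x (g x)%:E)%E.
Proof.
by move=> f0 fg; apply: ge0_le_integral => // x _; rewrite lee_fin.
Qed.

Lemma nat_integral_ge0_fin mu f F : (forall x, 0 <= f x) ->
  (\int[mu]_x (f x)%:E = F%:E)%E -> 0 <= F.
Proof.
by move=> f0 HF; rewrite -lee_fin -HF; apply: integral_ge0 => x _; rewrite lee_fin.
Qed.

Lemma nat_integral_lin mu f g (b c : R) :
  (forall x, 0 <= f x) -> (forall x, 0 <= g x) -> 0 <= b -> 0 <= c ->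
  (\int[mu]_x (b * f x + c * g x)%:E =
   b%:E * (\int[mu]_x (f x)%:E) + c%:E * (\int[mu]_x (g x)%:E))%E.
Proof.
move=> f0 g0 b0 c0; under eq_integral do rewrite EFinD !EFinM.
rewrite ge0_integralD //.
- by rewrite !ge0_integralZl_EFin // => x _; rewrite lee_fin.
- by move=> x _; rewrite -EFinM lee_fin mulr_ge0.
- by move=> x _; rewrite -EFinM lee_fin mulr_ge0.
Qed.

Lemma nat_integral_lin_fin mu f g (b c F G : R) :
  (forall x, 0 <= f x) -> (forall x, 0 <= g x) -> 0 <= b -> 0 <= c ->
  (\int[mu]_x (f x)%:E = F%:E)%E -> (\int[mu]_x (g x)%:E = G%:E)%E ->
  (\int[mu]_x (b * f x + c * g x)%:E = (b * F + c * G)%:E)%E.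
Proof. by move=> f0 g0 b0 c0 Ff Gg; rewrite nat_integral_lin // Ff Gg. Qed.

Lemma nat_integral_cst (mu : probability nat R) (c : R) :
  (\int[mu]_x c%:E = c%:E)%E.
Proof.
rewrite (@integral_cst _ _ _ mu setT _ c%:E) //.
by rewrite [X in (_ * X)%E]probability_setT mule1.
Qed.

(** Monotone convergence, in the only form used below: a strict lower bound on
    an integral is already witnessed by finitely many atoms. *)
Lemma nat_integral_truncate mu f (r : R) : (forall x, 0 <= f x) ->
  (r%:E < \int[mu]_x (f x)%:E)%E ->
  exists K, (r%:E < \sum_(0 <= k < K) ((f k)%:E * mu [set k]))%E.
Proof.
move=> f0; rewrite integral_natE => [|x]; last by rewrite lee_fin.
move=> rf; apply: contrapT => /forallNP H; move: rf; apply/negP; rewrite -leNgt.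
apply: lime_le; first by apply: is_cvg_nneseries => k _ _; rewrite mule_ge0 // lee_fin.
by apply: nearW => K; rewrite leNgt; apply/negP; exact: H.
Qed.

Lemma nat_integral_truncate_fin (mu : probability nat R) f (r : R) :
  (forall x, 0 <= f x) -> (r%:E < \int[mu]_x (f x)%:E)%E ->
  exists K, r < \sum_(k < K) (f k * fine (mu [set (k : nat)])).
Proof.
move=> f0 /(nat_integral_truncate f0)[K rK]; exists K; rewrite -lte_fin.
rewrite (lt_le_trans rK) // -sumEFin big_mkord; apply: lee_sum => k _.
by rewrite EFinM fineK // fin_num_measure.
Qed.

Lemma nat_integral_ge_sum (mu : probability nat R) f K : (forall x, 0 <= f x) ->
  ((\sum_(k < K) (f k * fine (mu [set (k : nat)])))%:E <= \int[mu]_x (f x)%:E)%E.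
Proof.
move=> f0; rewrite integral_natE => [|x]; last by rewrite lee_fin.
apply: le_trans (nneseries_lim_ge K _); last first.
  by move=> k _ _; rewrite mule_ge0 // lee_fin.
rewrite -sumEFin big_mkord; apply: lee_sum => k _.
by rewrite EFinM fineK // fin_num_measure.
Qed.

Lemma sum_integral_exp (mu : probability nat R) (s F : R) k x : 0 <= s ->
  (\int[mu]_y (s ^+ y)%:E = F%:E)%E ->
  (sum_integral mu k (fun y => (s ^+ y)%:E) x = (s ^+ x * F ^+ k)%:E)%E.
Proof.
move=> s0 HF; have sn0 y : 0 <= s ^+ y by exact: exprn_ge0.
have F0 : 0 <= F by exact: nat_integral_ge0_fin HF.
elim: k x => [|k IHk] x /=; first by rewrite mulr1.
under eq_integral do rewrite IHk exprD mulrAC -[_ * _]addr0 -[X in _ + X](mul0r 0).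
rewrite (nat_integral_lin_fin (g := fun=> 0) _ _ _ _ HF (nat_integral_cst mu 0)) //.
  by rewrite mul0r addr0 -mulrA -exprSr.
by rewrite mulr_ge0 // exprn_ge0.
Qed.

(** The derivative of [sum_integral_exp] in [s], that is [s * d/ds (s ^ x * F (s) ^ k)]
    with [A = s * F' (s)]. For [k = 0] the factor [k%:R] makes [k.-1] harmless. *)
Lemma sum_integral_dexp (mu : probability nat R) (s F A : R) k x : 0 <= s ->
  (\int[mu]_y (s ^+ y)%:E = F%:E)%E ->
  (\int[mu]_y (y%:R * s ^+ y)%:E = A%:E)%E ->
  (sum_integral mu k (fun y => (y%:R * s ^+ y)%:E) x =
   (x%:R * s ^+ x * F ^+ k + s ^+ x * (k%:R * F ^+ k.-1) * A)%:E)%E.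
Proof.
move=> s0 HF HA; have sn0 y : 0 <= s ^+ y by exact: exprn_ge0.
have F0 : 0 <= F by exact: nat_integral_ge0_fin HF.
have A0 : 0 <= A.
  by apply: nat_integral_ge0_fin HA => y; rewrite mulr_ge0.
elim: k x => [|k IHk] x /=; first by rewrite mulr1 mul0r mulr0 mul0r addr0.
transitivity (\int[mu]_y
  (((x%:R * s ^+ x * F ^+ k + s ^+ x * (k%:R * F ^+ k.-1) * A) * s ^+ y
   + (s ^+ x * F ^+ k) * (y%:R * s ^+ y)))%:E)%E.
  apply: eq_integral => y _; rewrite IHk natrD exprD; congr (_%:E); ring.
rewrite (nat_integral_lin_fin _ _ _ _ HF HA) //.
- congr (_%:E); case: k {IHk} => [|k]; first by rewrite /= !expr0; ring.
  by rewrite [k.+2%:R]mulrS /= !exprS; ring.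
- by move=> y; rewrite mulr_ge0.
- by rewrite addr_ge0 ?mulr_ge0 ?exprn_ge0.
- by rewrite mulr_ge0 ?exprn_ge0.
Qed.

Lemma tail_itv (mu : probability nat R) y : 0 <= fine (mu [set z | (y <= z)%N]) <= 1.
Proof.
rewrite fine_ge0 //= -lee_fin fineK ?fin_num_measure //; exact: probability_le1.
Qed.

Lemma nat_integral_tail (mu : probability nat R) y :
  (\int[mu]_z ((y <= z)%N%:R : R)%:E = (fine (mu [set z | (y <= z)%N]))%:E)%E.
Proof.
rewrite fineK ?fin_num_measure // -[in RHS](setIT [set z | _]).
rewrite -integral_indic //; apply: eq_integral => z _.
by rewrite indicE; congr (_%:R%:E); rewrite mem_setE.
Qed.

(** A sum of non-negative terms reaches [y] as soon as one of its terms
    does. *)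
Lemma sum_integral_tail (mu : probability nat R) (y k x : nat) :
  ((1 - (1 - fine (mu [set z | (y <= z)%N])) ^+ k)%:E <=
    sum_integral mu k (fun z => (y <= z)%N%:R%:E) x)%E.
Proof.
set q := fine _; pose g z : R := (y <= z)%N%:R.
have g0 z : 0 <= g z by exact: ler0n.
have S0 i z : (0 <= sum_integral mu i (EFin \o g) z)%E.
  by apply: sum_integral_ge0 => w; rewrite lee_fin.
have gS i z : ((g z)%:E <= sum_integral mu i (EFin \o g) z)%E.
  elim: i z => [|i IHi] z //=.
  rewrite -[X in (X <= _)%E](nat_integral_cst mu (g z)).
  apply: ge0_le_integral => // w _; first by rewrite lee_fin.
  apply: le_trans (IHi _); rewrite lee_fin /g ler_nat.
  by case: (leqP y z) => // yz; rewrite (leq_trans yz (leq_addr _ _)).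
have /andP[q0 q1] : 0 <= q <= 1 by exact: tail_itv.
elim: k x => [|k IHk] x; first by rewrite expr0 subrr; exact: (S0 0%N).
have r0 : 0 <= 1 - q by rewrite subr_ge0.
have r1 : (1 - q) ^+ k <= 1 by rewrite exprn_ile1 // gerBl.
have rk0 : 0 <= (1 - q) ^+ k by exact: exprn_ge0.
(* The next term reaches [y] by itself or leaves this to the others. *)
rewrite (_ : 1 - (1 - q) ^+ k.+1 = (1 - (1 - q) ^+ k) * 1 + (1 - q) ^+ k * q);
  last by rewrite exprS; ring.
rewrite -(nat_integral_lin_fin (f := fun=> 1) _ _ _ _ (nat_integral_cst mu 1)
  (nat_integral_tail mu y)) ?subr_ge0 //=.
apply: ge0_le_integral => // z _.
  by rewrite lee_fin addr_ge0 ?mulr_ge0 ?subr_ge0.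
case: (leqP y z) => yz.
  rewrite mulr1 mulr1 subrK; apply: le_trans (gS k _).
  by rewrite /g (leq_trans yz (leq_addl _ _)).
by rewrite mulr0 addr0 mulr1; exact: IHk.
Qed.

End NatIntegral.

(** * One step of the recursion on laws *)

Section Recursion.
Context (R : realType).
Implicit Types mu nu sigma : probability nat R.

(** One step of the recursion in terms of laws only: [sigma] is the law of the
    sum before [a] is subtracted. Keeping it apart lets one compare functions
    of [S] and of [S - a] under the same integral. *)
Definition dr_laws (a : nat) nu mu sigma mu' :=
  (forall g : nat -> R, (forall x, 0 <= g x) ->
     (\int[sigma]_x (g x)%:E =
      \int[nu]_k sum_integral mu k (fun x => (g x)%:E) 0)%E) /\
  (forall g : nat -> R, (forall x, 0 <= g x) ->
     (\int[mu']_x (g x)%:E = \int[sigma]_x (g (x - a)%N)%:E)%E).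

Lemma derrida_retaux_step_laws (a : nat)
    (dN : measure_display) (TN : measurableType dN) (PN : probability TN R)
    (N : {RV PN >-> nat})
    (d : measure_display) (T : measurableType d) (P : probability T R)
    (X : {RV P >-> nat})
    (d1 : measure_display) (T1 : measurableType d1) (P1 : probability T1 R)
    (X1 : {RV P1 >-> nat}) :
  derrida_retaux_step a N X X1 ->
  exists sigma, dr_laws a (distribution PN N) (distribution P X) sigma
    (distribution P1 X1).
Proof.
case=> d' [T'] [P'] [N'] [Y] [lawN lawY indep lawX1].
pose S w := (\sum_(j < N' w) Y j w)%N.
have mS : measurable_fun setT S.
  exact: (@random_sum_measurable _ _ N' (fun j => Y j)).
pose S' : {RV P' >-> nat} := HB.pack S (isMeasurableFun.Build _ _ _ _ S mS).
exists (distribution P' S'); split=> g g0.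
  rewrite ge0_integral_distribution //.
  rewrite [RHS](eq_measure_integral (distribution P' N')); last by move=> A _ _; exact: esym (lawN A).
  by rewrite -(@integral_random_sum _ _ _ _ _ Y (distribution P X)).
rewrite [RHS]ge0_integral_distribution // => [|y]; last by rewrite lee_fin.
have mSa : measurable_fun setT (fun w => (S w - a)%N).
  exact: (@measurableT_comp _ _ _ _ _ _ (fun x => (x - a)%N)).
pose Sa : {RV P' >-> nat} := HB.pack (fun w => (S w - a)%N)
  (isMeasurableFun.Build _ _ _ _ (fun w => (S w - a)%N) mSa).
rewrite [LHS](eq_measure_integral (distribution P' Sa)); last by move=> A _ _; exact: lawX1.
by rewrite ge0_integral_distribution // => y; rewrite lee_fin.
Qed.

Section Moments.
Context (a : nat) nu mu sigma mu' (dr : dr_laws a nu mu sigma mu').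

Lemma integral_sum_exp s F : 0 <= s -> (\int[mu]_y (s ^+ y)%:E = F%:E)%E ->
  (\int[sigma]_x (s ^+ x)%:E = \int[nu]_k (F ^+ k)%:E)%E.
Proof.
move=> s0 HF; rewrite dr.1 => [|x]; last exact: exprn_ge0.
by apply: eq_integral => k _; rewrite (sum_integral_exp _ _ s0 HF) expr0 mul1r.
Qed.

Lemma integral_sum_dexp s F A : 0 <= s ->
  (\int[mu]_y (s ^+ y)%:E = F%:E)%E ->
  (\int[mu]_y (y%:R * s ^+ y)%:E = A%:E)%E ->
  (\int[sigma]_x (x%:R * s ^+ x)%:E = A%:E * \int[nu]_k (k%:R * F ^+ k.-1)%:E)%E.
Proof.
move=> s0 HF HA; have sn0 y : 0 <= s ^+ y by exact: exprn_ge0.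
have F0 : 0 <= F by exact: nat_integral_ge0_fin HF.
have A0 : 0 <= A.
  by apply: nat_integral_ge0_fin HA => y; rewrite mulr_ge0.
rewrite dr.1 => [|x]; last by rewrite mulr_ge0.
rewrite -ge0_integralZl_EFin // => [|k _]; last first.
  by rewrite lee_fin mulr_ge0 ?exprn_ge0.
apply: eq_integral => k _; rewrite (sum_integral_dexp _ _ s0 HF HA).
by rewrite -EFinM expr0; congr (_%:E); ring.
Qed.

Lemma integral_sum_id e : (\int[mu]_y (y%:R)%:E = e%:E)%E ->
  (\int[sigma]_x (x%:R)%:E = e%:E * \int[nu]_k (k%:R)%:E)%E.
Proof.
move=> He; have one : (\int[mu]_y (1 ^+ y : R)%:E = 1%:E)%E.
  by under eq_integral do rewrite expr1n; exact: nat_integral_cst.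
have HA : (\int[mu]_y (y%:R * 1 ^+ y)%:E = e%:E)%E.
  by under eq_integral do rewrite expr1n mulr1.
have := integral_sum_dexp ler01 one HA.
under eq_integral do rewrite expr1n mulr1; move=> ->.
by congr (_ * _)%E; apply: eq_integral => k _; rewrite expr1n mulr1.
Qed.

(** [X_(n+1) >= y] as soon as one of the [N] terms is at least [y + a]. For
    [y = 0] truncation would break the equivalence of [y <= z - a] and
    [y + a <= z]. *)
Lemma tail_step y : (0 < y)%N ->
  (\int[nu]_k (1 - (1 - fine (mu [set z | (y + a <= z)%N])) ^+ k)%:E <=
   (fine (mu' [set z | (y <= z)%N]))%:E)%E.
Proof.
move=> y0; rewrite -nat_integral_tail dr.2 // dr.1 //.
have /andP[q0 q1] := tail_itv mu (y + a).
apply: ge0_le_integral => // k _.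
  by rewrite lee_fin subr_ge0 exprn_ile1 ?subr_ge0 // gerBl.
apply: le_trans (sum_integral_tail _ _ _ _) _.
rewrite le_eqVlt; apply/orP; left; apply/eqP; congr sum_integral.
apply/funext => z; congr (_%:R%:E); congr nat_of_bool.
by lia.
Qed.

End Moments.
End Recursion.

(** * Elementary inequalities *)

Section Elementary.
Context (R : realFieldType).
Implicit Types (s u q m F : R).

Lemma bernoulli_ge u n : -1 <= u -> 1 + n%:R * u <= (1 + u) ^+ n.
Proof.
move=> u1; elim: n => [|n IHn]; first by rewrite mul0r addr0.
rewrite exprSr; apply: le_trans (ler_wpM2r _ IHn); last by lra.
have : 0 <= n%:R * u ^+ 2 by rewrite mulr_ge0 // sqr_ge0.
by rewrite [n.+1%:R]mulrS; nra.
Qed.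

(** The slopes of the chords from [0] of the convex function [y |-> s ^ y]
    increase. *)
Lemma exp_chord s y a : 1 <= s -> (y <= a)%N ->
  a%:R * (s ^+ y - 1) <= y%:R * (s ^+ a - 1).
Proof.
move=> s1 ya; rewrite -(subnKC ya); elim: (a - y)%N => [|k IHk].
  by rewrite addn0.
have slope : s ^+ y - 1 <= y%:R * s ^+ (y + k) * (s - 1).
  rewrite subrX1 mulrC ler_wpM2r ?subr_ge0 //.
  rewrite mulr_natl -[X in _ *+ X](card_ord y) -sumr_const.
  apply: ler_sum => i _; apply: ler_weXn2l => //.
  by rewrite (leq_trans (ltnW (ltn_ord i))) // leq_addr.
rewrite addnS [(y + k).+1%:R]mulrS exprS.
move: IHk slope; move: (s ^+ (y + k)) ((y + k)%:R : R) (s ^+ y) => p K r.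
by nra.
Qed.

(** Inclusion-exclusion for the union of [k] independent events of
    probability [q], with a crude second-order term. *)
Lemma bonferroni_ge q k : 0 <= q <= 1 ->
  k%:R * q * (1 - k%:R * q) <= 1 - (1 - q) ^+ k.
Proof.
case/andP=> q0 q1; suff : (1 - q) ^+ k <= 1 - k%:R * q + (k%:R * q) ^+ 2 by nra.
elim: k => [|k IHk]; first by rewrite expr0; lra.
rewrite exprS; apply: le_trans (ler_wpM2l _ IHk) _; first by lra.
rewrite -natr1; have k0 : 0 <= (k%:R : R) by exact: ler0n.
have q20 : 0 <= q ^+ 2 by exact: sqr_ge0.
have : 0 <= (k%:R * q) ^+ 2 * q by rewrite mulr_ge0 // sqr_ge0.
have : 0 <= k%:R * q ^+ 2 by rewrite mulr_ge0 // sqr_ge0.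
by nra.
Qed.

(** Without truncation both sides are the same function of [x - a]. *)
Lemma drift_above s m a x :
  (a <= x)%N ->
  (m - 1) * s ^+ a * ((x - a)%:R * s ^+ (x - a)) + m * a%:R * s ^+ x =
  a%:R * s ^+ a * s ^+ (x - a) + (m - 1) * (x%:R * s ^+ x).
Proof. by move=> ax; rewrite -(subnKC ax) addKn natrD exprD; ring. Qed.

(** The comparison [h x <= phi (x - a)] of the introduction, multiplied by
    [s ^ a] and with the negative terms moved across, so that both sides can be
    integrated as non-negative functions. *)
Lemma drift_ge s m a x : 1 <= s -> s ^+ a <= m ->
  a%:R * s ^+ a * s ^+ (x - a) + (m - 1) * (x%:R * s ^+ x) <=
  (m - 1) * s ^+ a * ((x - a)%:R * s ^+ (x - a)) + m * a%:R * s ^+ x.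
Proof.
move=> s1 sm; case: (leqP a x) => [ax|/ltnW ax]; first by rewrite drift_above.
have chord : a%:R * s ^+ (a - x) <= a%:R + (a - x)%:R * (m - 1).
  rewrite addrC -lerBlDr -[X in _ - X]mulr1 -mulrBr.
  apply: le_trans (exp_chord s1 (leq_subr x a)) _.
  by rewrite ler_wpM2l ?ler0n // lerB.
rewrite (eqP ax) expr0 !mul0r mulr0 add0r mulr1.
have sx0 := exprn_ge0 x (le_trans ler01 s1).
have -> : s ^+ a = s ^+ x * s ^+ (a - x) by rewrite -exprD subnKC.
have aE : (a%:R : R) = x%:R + (a - x)%:R by rewrite -natrD subnKC.
by move: (ler_wpM2l sx0 chord); rewrite aE; nra.
Qed.

(** The value of [s] is the one for which [h (a - 1) = h a = - a]; as [h]
    decreases and then increases, [h < - a] is possible only strictly between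
    these two integers. *)
Lemma drift_le s m a x : 1 <= m -> (0 < a)%N -> s = 1 + (m - 1) / a%:R ->
  (m - 1) * s ^+ a * ((x - a)%:R * s ^+ (x - a)) + m * a%:R * s ^+ x <=
  a%:R * s ^+ a * s ^+ (x - a) + (m - 1) * (x%:R * s ^+ x).
Proof.
move=> m1 a0 sE; case: (leqP a x) => [ax|/ltnW ax]; first by rewrite drift_above.
have a0' : 0 < a%:R :> R by rewrite ltr0n.
have u0 : 0 <= (m - 1) / a%:R by rewrite divr_ge0 ?ler0n // subr_ge0.
have s0 : 0 <= s by rewrite sE; lra.
have bern : a%:R + (a - x)%:R * (m - 1) <= a%:R * s ^+ (a - x).
  rewrite sE; apply: le_trans (ler_wpM2l (ltW a0') (bernoulli_ge _ _)); last by lra.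
  by rewrite [leRHS]mulrDr mulr1 mulrCA (mulrCA a%:R) divff ?mulr1 // gt_eqF.
rewrite (eqP ax) expr0 !mul0r mulr0 add0r mulr1.
have sx0 := exprn_ge0 x s0.
have -> : s ^+ a = s ^+ x * s ^+ (a - x) by rewrite -exprD subnKC.
have aE : (a%:R : R) = x%:R + (a - x)%:R by rewrite -natrD subnKC.
by move: (ler_wpM2l sx0 bern); rewrite aE; nra.
Qed.

(** [(k - m) (F ^ k - F ^ m) >= 0], with the integer part [j] of [m] as
    exponent of the constant, which has the same effect at integers [k]. *)
Lemma exp_cov_ge (m F : R) (j k : nat) : 1 <= F -> j%:R <= m < j.+1%:R ->
  m * F ^+ k + k%:R * F ^+ j <= k%:R * F ^+ k + m * F ^+ j.
Proof.
move=> F1 /andP[jm mj]; case: (leqP k j) => kj.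
  have : (k%:R : R) <= m by apply: le_trans jm; rewrite ler_nat.
  by have := ler_weXn2l F1 kj; nra.
have : m <= k%:R by apply: le_trans (ltW mj) _; rewrite ler_nat.
by have := ler_weXn2l F1 (ltnW kj); nra.
Qed.

End Elementary.

(** * The drift of the generating function *)

Section OneStep.
Context (R : realType).
Implicit Types mu nu sigma : probability nat R.

Lemma le_nat_integral_supp mu (f g : nat -> R) :
  (forall k, 0 <= f k) -> (forall k, 0 <= g k) ->
  (forall k, mu [set k] != 0%E -> f k <= g k) ->
  (\int[mu]_k (f k)%:E <= \int[mu]_k (g k)%:E)%E.
Proof.
move=> f0 g0 fg; rewrite !integral_natE; last 2 first.
- by move=> k; rewrite lee_fin.
- by move=> k; rewrite lee_fin.
apply: lee_nneseries => [k _ _|k _]; first by rewrite mule_ge0 // lee_fin.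
have [k0|/fg fgk] := eqVneq (mu [set k]) 0%E.
  by rewrite [X in (_ * X <= _)%E]k0 [X in (_ <= _ * X)%E]k0 !mule0.
by rewrite lee_wpmul2r // lee_fin.
Qed.

Lemma nat_integral_fin mu (f : nat -> R) (b : \bar R) : (forall k, 0 <= f k) ->
  (\int[mu]_k (f k)%:E <= b)%E -> (b < +oo)%E ->
  exists r, (\int[mu]_k (f k)%:E = r%:E)%E.
Proof.
move=> f0 fb boo; exists (fine (\int[mu]_k (f k)%:E)%E); rewrite fineK //.
rewrite ge0_fin_numE; first exact: le_lt_trans boo.
by apply: integral_ge0 => k _; rewrite lee_fin.
Qed.

Lemma pgf_ge1 mu (s F : R) : 1 <= s ->
  (\int[mu]_y (s ^+ y)%:E = F%:E)%E -> 1 <= F.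
Proof.
move=> s1 HF; rewrite -lee_fin -HF -(nat_integral_cst mu 1).
by apply: le_nat_integral => // x; exact: exprn_ege1.
Qed.

Section Drift.
Context (a : nat) nu mu sigma mu' (dr : dr_laws a nu mu sigma mu').

(** Finiteness of the moments of [mu'] is what makes those of the sum finite,
    although [N] may be unbounded. The conclusion, [D' >= (m / s ^ a) D],
    is stated without division. *)
Lemma drift_lower (m s F A F' A' : R) : (0 < a)%N -> 1 < m ->
  (\int[nu]_k (k%:R)%:E = m%:E)%E -> 1 <= s -> s ^+ a <= m ->
  (\int[mu]_x (s ^+ x)%:E = F%:E)%E ->
  (\int[mu]_x (x%:R * s ^+ x)%:E = A%:E)%E ->
  (\int[mu']_x (s ^+ x)%:E = F'%:E)%E ->
  (\int[mu']_x (x%:R * s ^+ x)%:E = A'%:E)%E ->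
  0 <= (m - 1) * A - a%:R * F ->
  m * ((m - 1) * A - a%:R * F) <= s ^+ a * ((m - 1) * A' - a%:R * F').
Proof.
move=> a0 m1 Hm s1 sm HF HA HF' HA' D0.
have s0 : 0 <= s by lra.
have sn0 x : 0 <= s ^+ x by exact: exprn_ge0.
have xs0 x y : 0 <= x%:R * s ^+ y by rewrite mulr_ge0.
have F1 := pgf_ge1 s1 HF; have F0 : 0 <= F by lra.
have Fn0 x : 0 <= F ^+ x by exact: exprn_ge0.
have a0' : 0 < a%:R :> R by rewrite ltr0n.
have A0 : 0 < A by nra.
have sF' : (\int[sigma]_x (s ^+ (x - a))%:E = F'%:E)%E by rewrite -HF' dr.2.
have sA' : (\int[sigma]_x ((x - a)%:R * s ^+ (x - a))%:E = A'%:E)%E.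
  by rewrite -HA' dr.2.
have xE x : s ^+ x <= s ^+ a * s ^+ (x - a).
  by rewrite -exprD; apply: ler_weXn2l => //; lia.
have [G HG] : exists G, (\int[sigma]_x (s ^+ x)%:E = G%:E)%E.
  apply: (@nat_integral_fin _ _ (s ^+ a * F' + 0 * F')%:E) => //; last by rewrite ltry.
  rewrite -(nat_integral_lin_fin _ _ _ _ sF' sF') //.
  by apply: le_nat_integral => // x; rewrite mul0r addr0.
have [E HE] : exists E, (\int[sigma]_x (x%:R * s ^+ x)%:E = E%:E)%E.
  apply: (@nat_integral_fin _ _ (s ^+ a * A' + a%:R * s ^+ a * F')%:E) => //;
    last by rewrite ltry.
  rewrite -(nat_integral_lin_fin _ _ _ _ sA' sF') //.
  apply: le_nat_integral => // x; apply: le_trans (ler_wpM2l _ (xE x)) _ => //.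
  have : (x%:R : R) <= (x - a)%:R + a%:R by rewrite -natrD ler_nat; lia.
  by have : 0 <= s ^+ a * s ^+ (x - a) by [rewrite mulr_ge0|]; nra.
have HGn := HG; rewrite (integral_sum_exp dr s0 HF) in HGn.
have HEn := HE; rewrite (integral_sum_dexp dr s0 HF HA) in HEn.
have kF0 k : 0 <= k%:R * F ^+ k.-1 by rewrite mulr_ge0.
(* [A * E (N F ^ (N - 1))] is finite, and [A > 0]. *)
have [B HB] : exists B, (\int[nu]_k (k%:R * F ^+ k.-1)%:E = B%:E)%E.
  apply: (@nat_integral_fin _ _ (\int[nu]_k (k%:R * F ^+ k.-1)%:E)%E) => //.
  rewrite ltey; apply/eqP => BE; move: HEn; rewrite BE muleC mulyr gtr0_sg //.
  by rewrite mul1e.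
move: HEn; rewrite HB -EFinM => -[EB].
(* [k F ^ (k - 1) >= k], as [F >= 1]. *)
have Bm : m <= B.
  rewrite -lee_fin -Hm -HB; apply: le_nat_integral => // k.
  by rewrite ler_peMr // exprn_ege1.
have drift : a%:R * s ^+ a * F' + (m - 1) * E <= (m - 1) * s ^+ a * A' + m * a%:R * G.
  rewrite -lee_fin.
  rewrite -(nat_integral_lin_fin _ _ _ _ sF' HE) ?mulr_ge0 //; last lra.
  rewrite -(nat_integral_lin_fin _ _ _ _ sA' HG) ?mulr_ge0 //; [|lra|lra].
  apply: le_nat_integral => x; last exact: drift_ge.
  by rewrite addr_ge0 // mulr_ge0 // ?mulr_ge0 //; lra.
have cov : m * G <= F * B.
  pose j := Num.truncn m.
  have jm : j%:R <= m < j.+1%:R by apply: Num.Theory.truncn_itv; lra.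
  (* The constant [F ^ j] integrates to [F ^ j m] on both sides and cancels. *)
  suff : m * G + F ^+ j * m <= F * B + (m * F ^+ j) * 1 by lra.
  rewrite -lee_fin -(nat_integral_lin_fin _ _ _ _ HGn Hm) //; last lra.
  rewrite -(nat_integral_lin_fin _ _ _ _ HB (nat_integral_cst nu 1)) //;
    last by rewrite mulr_ge0 //; lra.
  apply: le_nat_integral => k; first by rewrite addr_ge0 // mulr_ge0 //; lra.
  rewrite mulr1 [F ^+ j * _]mulrC.
  apply: le_trans (exp_cov_ge k F1 jm) _; rewrite lerD2r.
  by case: k => [|k]; rewrite ?mul0r ?mulr0 //= mulrCA -exprS.
have : m * ((m - 1) * A - a%:R * F) <= B * ((m - 1) * A - a%:R * F) by nra.
by have := ler_wpM2l (ltW a0') cov; rewrite -EB in drift; nra.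
Qed.

(** Here [N] is bounded, so the sum inherits finite moments from [mu], and [mu']
    from the sum. *)
Lemma drift_upper (M s F A : R) : (0 < a)%N -> 1 <= M ->
  (forall k, nu [set k] != 0%E -> k%:R <= M) -> s = 1 + (M - 1) / a%:R ->
  (\int[mu]_x (s ^+ x)%:E = F%:E)%E ->
  (\int[mu]_x (x%:R * s ^+ x)%:E = A%:E)%E ->
  (M - 1) * A - a%:R * F <= 0 ->
  exists F' A', [/\ (\int[mu']_x (s ^+ x)%:E = F'%:E)%E,
    (\int[mu']_x (x%:R * s ^+ x)%:E = A'%:E)%E &
    (M - 1) * A' - a%:R * F' <= 0].
Proof.
move=> a0 M1 suppM sE HF HA D0.
have a0' : 0 < a%:R :> R by rewrite ltr0n.
have s1 : 1 <= s by rewrite sE lerDl divr_ge0 // subr_ge0.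
have s0 : 0 <= s by lra.
have sn0 x : 0 <= s ^+ x by exact: exprn_ge0.
have xs0 x y : 0 <= x%:R * s ^+ y by rewrite mulr_ge0.
have F1 := pgf_ge1 s1 HF; have F0 : 0 <= F by lra.
have Fn0 x : 0 <= F ^+ x by exact: exprn_ge0.
have kF0 k : 0 <= k%:R * F ^+ k.-1 by rewrite mulr_ge0.
pose K := Num.truncn M.
have suppK k : nu [set k] != 0%E -> (k <= K)%N.
  by move=> /suppM kM; rewrite /K truncn_ge_nat //; lra.
have [G HGn] : exists G, (\int[nu]_k (F ^+ k)%:E = G%:E)%E.
  apply: (@nat_integral_fin _ _ (F ^+ K)%:E) => //; last by rewrite ltry.
  rewrite -(nat_integral_cst nu); apply: le_nat_integral_supp => // k /suppK kK.
  exact: ler_weXn2l.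
have [B HB] : exists B, (\int[nu]_k (k%:R * F ^+ k.-1)%:E = B%:E)%E.
  apply: (@nat_integral_fin _ _ (K%:R * F ^+ K)%:E) => //; last by rewrite ltry.
  rewrite -(nat_integral_cst nu); apply: le_nat_integral_supp => [//|k|k /suppK kK].
    by rewrite mulr_ge0.
  apply: ler_pM => //; first by rewrite ler_nat.
  by apply: ler_weXn2l => //; lia.
have HG : (\int[sigma]_x (s ^+ x)%:E = G%:E)%E by rewrite (integral_sum_exp dr s0 HF).
have HE : (\int[sigma]_x (x%:R * s ^+ x)%:E = (A * B)%:E)%E.
  by rewrite (integral_sum_dexp dr s0 HF HA) HB.
have [F' HF'] : exists F', (\int[mu']_x (s ^+ x)%:E = F'%:E)%E.
  apply: (@nat_integral_fin _ _ G%:E) => //; last by rewrite ltry.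
  rewrite dr.2 // -HG; apply: le_nat_integral => // x.
  by apply: ler_weXn2l => //; lia.
have [A' HA'] : exists A', (\int[mu']_x (x%:R * s ^+ x)%:E = A'%:E)%E.
  apply: (@nat_integral_fin _ _ (A * B)%:E) => //; last by rewrite ltry.
  rewrite dr.2 // -HE; apply: le_nat_integral => // x.
  apply: ler_pM => //; first by rewrite ler_nat; lia.
  by apply: ler_weXn2l => //; lia.
exists F', A'; split => //.
have sF' : (\int[sigma]_x (s ^+ (x - a))%:E = F'%:E)%E by rewrite -HF' dr.2.
have sA' : (\int[sigma]_x ((x - a)%:R * s ^+ (x - a))%:E = A'%:E)%E.
  by rewrite -HA' dr.2.
have drift : (M - 1) * s ^+ a * A' + M * a%:R * G <=
    a%:R * s ^+ a * F' + (M - 1) * (A * B).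
  rewrite -lee_fin.
  rewrite -(nat_integral_lin_fin _ _ _ _ sF' HE) ?mulr_ge0 //; last lra.
  rewrite -(nat_integral_lin_fin _ _ _ _ sA' HG) ?mulr_ge0 //; [|lra|lra].
  apply: le_nat_integral => x; last exact: drift_le.
  by rewrite addr_ge0 // mulr_ge0 // ?mulr_ge0 //; lra.
have cov : F * B <= M * G.
  suff : F * B + 0 * 1 <= M * G + 0 * 1 by lra.
  rewrite -lee_fin -(nat_integral_lin_fin _ _ _ _ HB (nat_integral_cst nu 1)) //.
  rewrite -(nat_integral_lin_fin _ _ _ _ HGn (nat_integral_cst nu 1)) //; last lra.
  apply: le_nat_integral_supp => [k|k|k /suppM kM]; rewrite !mul0r !addr0.
  - by rewrite mulr_ge0.
  - by rewrite mulr_ge0 //; lra.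
  - apply: (@le_trans _ _ (k%:R * F ^+ k)); last exact: ler_wpM2r.
    by case: k {kM} => [|k]; rewrite ?mul0r ?mulr0 //= mulrCA -exprS.
have B0 : 0 <= B by exact: nat_integral_ge0_fin HB.
have sa0 : 0 < s ^+ a by apply: exprn_gt0; lra.
rewrite -(pmulr_rle0 _ sa0).
by have := ler_wpM2l (ltW a0') cov; have := ler_wpM2l B0 D0; nra.
Qed.

End Drift.
End OneStep.

(** * Uniform exponential tails *)

Section Tail.
Context (R : realType).
Implicit Types mu nu sigma : probability nat R.

(** With success probability [q], the probability of a success in [N] trials
    is [m q (1 - o(1))]. To have a uniform [o(1)] without a second moment of
    [N], only the finitely many values of [N] that carry a mean above [r]
    are counted. *)
Lemma some_success_ge nu (m r : R) : (\int[nu]_k (k%:R)%:E = m%:E)%E ->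
  0 <= r < m -> exists2 q0 : R, 0 < q0 & forall q : R, 0 <= q <= q0 ->
  ((r * q)%:E <= \int[nu]_k (1 - (1 - q) ^+ k)%:E)%E.
Proof.
move=> Hm /andP[r0 rm].
have [] := @nat_integral_truncate_fin _ nu (fun k => k%:R) r _ _ => //.
  by rewrite Hm lte_fin.
move=> K; set m' := \sum_(k < K) _ => rm'.
have m'0 : 0 < m' by lra.
pose q1 := (m' - r) / (K%:R * m' + 1).
have den0 : 0 < K%:R * m' + 1 by have := ler0n R K; nra.
exists (Num.min 1 q1) => [|q]; first by rewrite lt_min ltr01 divr_gt0 // subr_gt0.
rewrite le_min => /and3P[q0 q1' qq1]; have q01 : 0 <= q <= 1 by rewrite q0.
apply: le_trans (nat_integral_ge_sum (f := fun k => 1 - (1 - q) ^+ k) _ K _);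
  last first.
  by move=> k; rewrite subr_ge0 exprn_ile1 //; lra.
rewrite lee_fin; apply: (@le_trans _ _ (q * (1 - K%:R * q) * m')).
  have : q * (K%:R * m' + 1) <= m' - r by rewrite -ler_pdivlMr.
  by have := mulr_ge0 q0 q0; nra.
rewrite mulr_sumr; apply: ler_sum => k _; rewrite mulrA ler_wpM2r ?fine_ge0 //.
apply: le_trans (bonferroni_ge k q01); rewrite mulrC mulrA.
have kK : (k%:R : R) <= K%:R by rewrite ler_nat ltnW.
rewrite ler_wpM2l ?mulr_ge0 ?ler0n // lerB // ler_wpM2r //.
Qed.

Lemma tail_le mu x y : (x <= y)%N ->
  fine (mu [set z | (y <= z)%N]) <= fine (mu [set z | (x <= z)%N]).
Proof.
move=> xy; apply: fine_le; rewrite ?fin_num_measure //.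
by apply: le_measure; rewrite ?inE // => z /=; exact: leq_trans.
Qed.

Lemma tail_markov mu (c : R) y : (\int[mu]_x (x%:R)%:E <= c%:E)%E ->
  y%:R * fine (mu [set z | (y <= z)%N]) <= c.
Proof.
move=> muc; rewrite -lee_fin; apply: le_trans muc.
rewrite EFinM -nat_integral_tail -ge0_integralZl_EFin //.
apply: ge0_le_integral => // z _; rewrite -EFinM lee_fin -natrM ?ler0n // ler_nat.
by case: (leqP y z); rewrite ?muln1 ?muln0.
Qed.

Section Uniform.
Context (a : nat) nu (mu sigma : nat -> probability nat R).
Context (dr : forall n, dr_laws a nu (mu n) (sigma n) (mu n.+1)).
Context (m c t : R) (a0 : (0 < a)%N).
Context (Hm : (\int[nu]_k (k%:R)%:E = m%:E)%E).
Context (Hc : forall n, (\int[mu n]_x (x%:R)%:E <= c%:E)%E).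
Context (t1 : 1 <= t) (tm : t ^+ a < m).

Let tl n y := fine (mu n [set z | (y <= z)%N]).

(** As long as tails stay below [q0], a step multiplies them by at least
    [t ^ a] while lowering the level by [a]; but at a level [L] with
    [L * q0 > c] they do stay below [q0], by the inequality of Markov. Thus the
    tail at level [L + k a] is at most [t ^ - (k a)]. *)
Lemma tail_uniform : exists2 C : R, 0 <= C & forall n x, tl n x <= C / t ^+ x.
Proof.
have t0 : 0 < t := lt_le_trans ltr01 t1.
have r1 : 1 <= t ^+ a by exact: exprn_ege1.
have [q0 q00 thin] : exists2 q0 : R, 0 < q0 & forall q : R, 0 <= q <= q0 ->
    ((t ^+ a * q)%:E <= \int[nu]_k (1 - (1 - q) ^+ k)%:E)%E.
  by apply: some_success_ge Hm _; rewrite tm andbT; lra.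
have step n y : (0 < y)%N -> t ^+ a * Num.min q0 (tl n (y + a)) <= tl n.+1 y.
  move=> y0; rewrite -lee_fin; apply: le_trans (tail_step (dr n) y0).
  have /andP[p0 p1] := tail_itv (mu n) (y + a).
  set p := fine _ in p0 p1 *; have -> : tl n (y + a) = p by [].
  have q_ge : 0 <= Num.min q0 p by rewrite le_min p0 ltW.
  have qp : Num.min q0 p <= p by rewrite ge_min lexx orbT.
  apply: le_trans (thin _ _) _; first by rewrite q_ge ge_min lexx.
  apply: le_nat_integral => k; first by rewrite subr_ge0 exprn_ile1 //; lra.
  by rewrite lerB // lerXn2r ?nnegrE; lra.
have steps k n y : (0 < y)%N ->
    Num.min q0 ((t ^+ a) ^+ k * tl n (y + k * a)) <= tl (n + k) y.
  elim: k n => [|k IHk] n y0.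
    by rewrite expr0 mul1r mul0n !addn0 ge_min lexx orbT.
  rewrite addnS -addSn; apply: le_trans (IHk n.+1 y0).
  rewrite le_min ge_min lexx /=.
  have := step n (y + k * a)%N (leq_trans y0 (leq_addr _ _)).
  rewrite -addnA [(k * a + a)%N]addnC -mulSn => st.
  have rk1 : 1 <= (t ^+ a) ^+ k by exact: exprn_ege1.
  apply: le_trans (ler_wpM2l _ st); last by lra.
  rewrite mulrA -exprSr minr_pMr; last by apply: exprn_ge0; lra.
  rewrite le_min !ge_min lexx orbT andbT; apply/orP; left.
  by rewrite ler_peMl ?exprn_ege1 // ltW.
have [L L0 LC] : exists2 L : nat, (0 < L)%N & c < L%:R * q0.
  exists (Num.truncn (`|c| / q0)).+1 => //.
  rewrite -ltr_pdivrMr //; apply: le_lt_trans (truncnS_gt _).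
  by rewrite ler_pM2r ?invr_gt0 // ler_norm.
have tlL n : tl n L < q0.
  have Lpos : 0 < L%:R :> R by rewrite ltr0n.
  by rewrite -(ltr_pM2l Lpos); apply: le_lt_trans LC; exact: tail_markov.
have bnd k n : (t ^+ a) ^+ k * tl n (L + k * a) <= 1.
  have := steps k n L L0; rewrite ge_min leNgt tlL /= => /le_trans; apply.
  by have /andP[] := tail_itv (mu (n + k)%N) L.
(* [L + a] absorbs the levels below [L] and the remainder of [x - L] mod [a]. *)
exists (t ^+ (L + a)) => [|n x]; first exact: exprn_ge0 (ltW t0).
have tx0 : 0 < t ^+ x by exact: exprn_gt0.
have /andP[p0 p1] := tail_itv (mu n) x.
rewrite ler_pdivlMr //; case: (ltnP x L) => xL.
  rewrite -[X in _ <= X]mul1r; apply: ler_pM => //; first exact: ltW.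
  by apply: ler_weXn2l => //; lia.
pose k := ((x - L) %/ a)%N.
have kE := divn_eq (x - L) a; have kr := ltn_pmod (x - L) a0.
rewrite -/k in kE.
apply: (@le_trans _ _ (tl n (L + k * a) * t ^+ (L + a + a * k))).
  apply: ler_pM => //; first exact: ltW.
  - by apply: tail_le; lia.
  - by apply: ler_weXn2l => //; lia.
rewrite exprD exprM mulrCA -[X in _ <= X]mulr1 ler_wpM2l //.
  exact: exprn_ge0 (ltW t0).
by rewrite mulrC bnd.
Qed.

End Uniform.

Lemma exp_moment_tail mu (C s t : R) : 0 <= C -> 0 <= s < t ->
  (forall x, fine (mu [set z | (x <= z)%N]) <= C / t ^+ x) ->
  (\int[mu]_x (s ^+ x)%:E <= (C / (1 - s / t))%:E)%E.
Proof.
move=> C0 /andP[s0 st] tlC; have t0 : 0 < t by lra.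
rewrite leNgt; apply/negP => /nat_integral_truncate_fin[x|K].
  exact: exprn_ge0.
apply/negP; rewrite -leNgt.
have u0 : 0 <= s / t by rewrite divr_ge0 // ltW.
have u1 : 0 < 1 - s / t by rewrite subr_gt0 ltr_pdivrMr // mul1r.
apply: (@le_trans _ _ (\sum_(k < K) C * (s / t) ^+ k)).
  apply: ler_sum => k _; rewrite expr_div_n mulrCA ler_wpM2l ?exprn_ge0 //.
  apply: le_trans (tlC k); apply: fine_le; rewrite ?fin_num_measure //.
  by apply: le_measure; rewrite ?inE // => z /= ->.
rewrite -mulr_sumr ler_wpM2l // -[leRHS]mul1r ler_pdivlMr // mulrC.
rewrite -opprB mulNr -subrX1 opprB; have := exprn_ge0 K u0; lra.
Qed.

(** The factor [x] costs an arbitrarily small increase of the base, from [s]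
    to the midpoint of [s] and [t]. *)
Lemma dexp_moment_tail mu (C s t : R) : 0 <= C -> 0 < s < t ->
  (forall x, fine (mu [set z | (x <= z)%N]) <= C / t ^+ x) ->
  (\int[mu]_x (x%:R * s ^+ x)%:E <=
   (C / (1 - (s + t) / 2 / t) / ((s + t) / 2 / s - 1))%:E)%E.
Proof.
move=> C0 /andP[s0 st] tlC.
set s1 := (s + t) / 2; have s1s : s < s1 by rewrite /s1; lra.
have u0 : 0 < s1 / s - 1 by rewrite subr_gt0 ltr_pdivlMr // mul1r.
have := @exp_moment_tail mu C s1 t C0 _ tlC.
have -> : 0 <= s1 < t by rewrite /s1; lra.
move=> /(_ isT) H; rewrite mulrC EFinM.
apply: le_trans (lee_wpmul2l _ H); last by rewrite lee_fin invr_ge0 ltW.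
rewrite -ge0_integralZl_EFin //; last 2 first.
- by move=> x _; rewrite lee_fin exprn_ge0 //; lra.
- by rewrite invr_ge0 ltW.
apply: ge0_le_integral => // x _.
  by rewrite lee_fin mulr_ge0 // exprn_ge0 // ltW.
rewrite -EFinM lee_fin ler_pdivlMl //.
have -> : s1 ^+ x = (s1 / s) ^+ x * s ^+ x.
  by rewrite -exprMn divfK // gt_eqF.
rewrite mulrA ler_wpM2r ?exprn_ge0 ?(ltW s0) //.
have u1 : -1 <= s1 / s - 1 by lra.
have := bernoulli_ge x u1; rewrite addrCA subrr addr0; lra.
Qed.

End Tail.

(** * Means and the free energy *)

Section FreeEnergyDichotomy.
Context (R : realType).
Implicit Types mu nu sigma : probability nat R.

Lemma mean_step a nu mu sigma mu' (dr : dr_laws a nu mu sigma mu') (m e : R) :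
  (\int[nu]_k (k%:R)%:E = m%:E)%E -> (\int[mu]_x (x%:R)%:E = e%:E)%E ->
  exists2 e', (\int[mu']_x (x%:R)%:E = e'%:E)%E & m * e - a%:R <= e' <= m * e.
Proof.
move=> Hm He; have Hs : (\int[sigma]_x (x%:R)%:E = (m * e)%:E)%E.
  by rewrite (integral_sum_id dr He) Hm -EFinM mulrC.
have [e' He'] : exists e', (\int[mu']_x (x%:R)%:E = e'%:E)%E.
  apply: (@nat_integral_fin _ _ _ (m * e)%:E) => //; last by rewrite ltry.
  by rewrite dr.2 // -Hs; apply: le_nat_integral => // x; rewrite ler_nat leq_subr.
exists e' => //; apply/andP; split; rewrite -lee_fin; last first.
  by rewrite -He' -Hs dr.2 //; apply: le_nat_integral => // x; rewrite ler_nat leq_subr.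
have He's : (\int[sigma]_x ((x - a)%:R : R)%:E = e'%:E)%E by rewrite -He' dr.2.
have sa := @nat_integral_lin_fin _ sigma (fun x => (x - a)%:R) (fun=> 1) 1 a%:R _ _
  _ _ _ _ He's (nat_integral_cst sigma 1).
rewrite lee_fin lerBlDr -[e']mul1r -[a%:R]mulr1 -lee_fin -sa // -Hs.
apply: le_nat_integral => // x; rewrite mul1r mulr1 -natrD ler_nat; lia.
Qed.

(** The weight [s ^ x] favours large [x]: [(x - c) (s ^ x - s ^ c) >= 0]. Hence
    [E ((X - c) s ^ X) <= 0] leaves no room for [E (X - c) > 0]. *)
Lemma mean_le_of_pgf mu (c s F A e : R) : 0 <= c -> 1 <= s ->
  (\int[mu]_x (s ^+ x)%:E = F%:E)%E ->
  (\int[mu]_x (x%:R * s ^+ x)%:E = A%:E)%E ->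
  (\int[mu]_x (x%:R)%:E = e%:E)%E -> A <= c * F -> e <= c.
Proof.
move=> c0 s1 HF HA He AF; have s0 : 0 < s by lra.
have sn0 x : 0 <= s ^+ x by rewrite exprn_ge0 // ltW.
pose j := Num.truncn c; have jc : j%:R <= c < j.+1%:R by exact: truncn_itv.
have sj : 0 < s ^+ j by exact: exprn_gt0.
suff H : c * F + s ^+ j * e <= 1 * A + (c * s ^+ j) * 1.
  by rewrite -(ler_pM2l sj); lra.
rewrite -lee_fin -(nat_integral_lin_fin _ _ _ _ HF He) //.
rewrite -(nat_integral_lin_fin _ _ _ _ HA (nat_integral_cst mu 1)) //;
  [|by move=> x; rewrite mulr_ge0|by rewrite mulr_ge0].
apply: le_nat_integral => x; first by rewrite addr_ge0 // mulr_ge0.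
by have := exp_cov_ge x s1 jc; rewrite mul1r mulr1 [s ^+ j * _]mulrC.
Qed.

(** Lowering the base only lowers [b * F], and finitely many terms of [A], which
    depend continuously on the base, already exceed [b * F]. *)
Lemma gt_at_smaller_base mu (b s0 F A : R) : 1 < s0 -> 0 <= b ->
  (\int[mu]_x (s0 ^+ x)%:E = F%:E)%E ->
  (\int[mu]_x (x%:R * s0 ^+ x)%:E = A%:E)%E -> b * F < A ->
  exists s F' A', [/\ 1 <= s < s0, (\int[mu]_x (s ^+ x)%:E = F'%:E)%E,
    (\int[mu]_x (x%:R * s ^+ x)%:E = A'%:E)%E & b * F' < A'].
Proof.
move=> s01 b0 HF HA FA.
have s00 : 0 < s0 by lra.
have F0 := pgf_ge1 (ltW s01) HF.
have [x||K] := @nat_integral_truncate_fin _ mu (fun x => x%:R * s0 ^+ x) (b * F).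
- by rewrite mulr_ge0 // exprn_ge0 // ltW.
- by rewrite HA lte_fin.
set U := \sum_(k < K) _ => bU.
have U0 : 0 < U by nra.
have den0 : 0 < K%:R * U + 1 by have := ler0n R K; nra.
pose e1 := (U - b * F) / (K%:R * U + 1).
pose ep := Num.min (1 - s0^-1) e1.
have si1 : s0^-1 < 1 by rewrite invf_lt1.
have si0 : 0 < s0^-1 by rewrite invr_gt0.
have ep0 : 0 < ep by rewrite lt_min subr_gt0 si1 divr_gt0 // subr_gt0.
have eps : ep <= 1 - s0^-1 by rewrite ge_min lexx.
have epe : ep * (K%:R * U + 1) <= U - b * F.
  by rewrite -ler_pdivlMr // ge_min lexx orbT.
(* The ratio [u] of the bases ensures [u ^ K U > b F] and [u s0 >= 1]. *)
pose u := 1 - ep; have u0 : 0 < u by rewrite /u; lra.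
have u1 : u < 1 by rewrite /u; lra.
have us1 : 1 <= u * s0 by rewrite -ler_pdivrMr // div1r /u; lra.
have us : u * s0 < s0 by rewrite gtr_pMl.
have us0 : 0 < u * s0 by exact: mulr_gt0.
have le_us x : (u * s0) ^+ x <= s0 ^+ x by rewrite lerXn2r // ?nnegrE ltW.
have usn0 x : 0 <= (u * s0) ^+ x by rewrite exprn_ge0 // ltW.
have [F' HF'] : exists F', (\int[mu]_x ((u * s0) ^+ x)%:E = F'%:E)%E.
  apply: (@nat_integral_fin _ _ _ F%:E) => //; last by rewrite ltry.
  by rewrite -HF; exact: le_nat_integral.
have xn0 x : 0 <= x%:R * (u * s0) ^+ x by rewrite mulr_ge0.
have [A' HA'] : exists A', (\int[mu]_x (x%:R * (u * s0) ^+ x)%:E = A'%:E)%E.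
  apply: (@nat_integral_fin _ _ _ A%:E) => //; last by rewrite ltry.
  by rewrite -HA; apply: le_nat_integral => // x; rewrite ler_wpM2l.
exists (u * s0), F', A'; split=> //; first by rewrite us1.
have FF' : F' <= F by rewrite -lee_fin -HF -HF'; exact: le_nat_integral.
have : u ^+ K * U <= A'.
  rewrite -lee_fin -HA'.
  apply: le_trans (nat_integral_ge_sum mu K xn0); rewrite lee_fin mulr_sumr.
  apply: ler_sum => k _; rewrite exprMn mulrA ler_wpM2r ?fine_ge0 //.
  rewrite mulrCA ler_wpM2l // ler_wpM2r ?exprn_ge0 ?(ltW s00) //.
  by apply: ler_wiXn2l; [exact: ltW|exact: ltW|exact: ltnW].
have eN1 : -1 <= - ep by lra.
have := bernoulli_ge K eN1; rewrite -/u => /(ler_wpM2r (ltW U0)) uK.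
have := ler_wpM2l b0 FF'; nra.
Qed.

Section Sequence.
Context (a : nat) nu (mu sigma : nat -> probability nat R).
Context (dr : forall n, dr_laws a nu (mu n) (sigma n) (mu n.+1)).
Context (m : R) (e : nat -> R) (a0 : (0 < a)%N) (m1 : 1 < m).
Context (Hm : (\int[nu]_k (k%:R)%:E = m%:E)%E).
Context (He : forall n, (\int[mu n]_x (x%:R)%:E = (e n)%:E)%E).

Lemma supercritical_mean (s0 F A : R) : 1 < s0 -> s0 ^+ a = m ->
  (\int[mu 0%N]_x (s0 ^+ x)%:E = F%:E)%E ->
  (\int[mu 0%N]_x (x%:R * s0 ^+ x)%:E = A%:E)%E ->
  0 < (m - 1) * A - a%:R * F -> exists n, a%:R < (m - 1) * e n.
Proof.
move=> s01 s0a HF HA D0; apply: contrapT => /forallNP small.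
have m10 : 0 < m - 1 by rewrite subr_gt0.
have Hc n : (\int[mu n]_x (x%:R)%:E <= (a%:R / (m - 1))%:E)%E.
  by rewrite He lee_fin ler_pdivlMr // mulrC leNgt; apply/negP; exact: small.
have [] := @gt_at_smaller_base (mu 0%N) (a%:R / (m - 1)) s0 F A s01 _ HF HA.
- by rewrite divr_ge0 // ltW.
- by rewrite mulrAC ltr_pdivrMr // mulrC; lra.
move=> s [F0 [A0 [/andP[s1 ss0] HF0 HA0 FA0]]].
have sp : 0 < s by lra.
pose t := (s + s0) / 2.
have st : s < t by rewrite /t; lra.
have ts0 : t < s0 by rewrite /t; lra.
have t1 : 1 <= t by lra.
have ta : t ^+ a < m.
  by rewrite -s0a ltrXn2r // ?nnegrE ?lt0n_neq0 //; lra.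
have sa : s ^+ a < m.
  by apply: le_lt_trans ta; rewrite lerXn2r // ?nnegrE; lra.
have [C C0 tlC] := tail_uniform dr a0 Hm Hc t1 ta.
have HFn n : exists Fn, (\int[mu n]_x (s ^+ x)%:E = Fn%:E)%E.
  apply: (@nat_integral_fin _ _ _ (C / (1 - s / t))%:E) => //; last by rewrite ltry.
    by move=> x; rewrite exprn_ge0 // ltW.
  by apply: exp_moment_tail => //; rewrite ltW.
pose B := C / (1 - (s + t) / 2 / t) / ((s + t) / 2 / s - 1).
have HB n : (\int[mu n]_x (x%:R * s ^+ x)%:E <= B%:E)%E.
  by apply: dexp_moment_tail => //; rewrite sp.
have HAn n : exists An, (\int[mu n]_x (x%:R * s ^+ x)%:E = An%:E)%E.
  apply: (@nat_integral_fin _ _ _ B%:E) => //; last by rewrite ltry.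
  by move=> x; rewrite mulr_ge0 // exprn_ge0 // ltW.
have /choice[Fn {}HFn] := HFn; have /choice[An {}HAn] := HAn.
pose D n := (m - 1) * An n - a%:R * Fn n.
have Fn0 n : 1 <= Fn n by exact: pgf_ge1 (HFn n).
have AB n : An n <= B by rewrite -lee_fin -HAn.
have D00 : 0 < D 0%N.
  rewrite /D.
  have [->] : EFin (An 0%N) = EFin A0 by rewrite -HAn.
  have [->] : EFin (Fn 0%N) = EFin F0 by rewrite -HFn.
  by move: FA0; rewrite mulrAC ltr_pdivrMr //; lra.
have sa0 : 0 < s ^+ a by exact: exprn_gt0.
pose rho := m / s ^+ a - 1.
have rho0 : 0 < rho by rewrite subr_gt0 ltr_pdivlMr // mul1r.
have grow n : (1 + n%:R * rho) * D 0%N <= D n.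
  suff : (1 + rho) ^+ n * D 0%N <= D n.
    apply: le_trans; rewrite ler_wpM2r ?(ltW D00) //.
    by apply: bernoulli_ge; lra.
  elim: n => [|n IHn]; first by rewrite expr0 mul1r.
  have Dn0 : 0 <= D n.
    by apply: le_trans IHn; rewrite mulr_ge0 ?(ltW D00) // exprn_ge0 //; lra.
  rewrite exprS -mulrA; apply: le_trans (ler_wpM2l _ IHn) _; first by lra.
  rewrite /rho addrC subrK mulrAC ler_pdivrMr // [leRHS]mulrC.
  exact: (drift_lower (dr n) a0 m1 Hm s1 (ltW sa) (HFn n) (HAn n) (HFn n.+1) (HAn n.+1)).
pose n := (Num.truncn ((m - 1) * `|B| / D 0%N / rho)).+1.
have : (m - 1) * `|B| / D 0%N / rho < n%:R by exact: truncnS_gt.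
rewrite !ltr_pdivrMr // => nB.
have := grow n; rewrite leNgt => /negP; apply.
have DB : D n <= (m - 1) * `|B|.
  have : (m - 1) * An n <= (m - 1) * `|B|.
    by rewrite ler_wpM2l ?(ltW m10) // (le_trans (AB n)) // ler_norm.
  have : 0 <= a%:R * Fn n by rewrite mulr_ge0 //; have := Fn0 n; lra.
  rewrite /D; lra.
by apply: le_lt_trans DB _; lra.
Qed.

Lemma subcritical_mean (M F A : R) : 1 < M ->
  (forall k, nu [set k] != 0%E -> k%:R <= M) ->
  let s := 1 + (M - 1) / a%:R in
  (\int[mu 0%N]_x (s ^+ x)%:E = F%:E)%E ->
  (\int[mu 0%N]_x (x%:R * s ^+ x)%:E = A%:E)%E ->
  (M - 1) * A - a%:R * F < 0 -> forall n, e n <= a%:R / (M - 1).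
Proof.
move=> M1 suppM s HF HA D0 n.
have M10 : 0 < M - 1 by lra.
have s1 : 1 <= s by rewrite /s lerDl divr_ge0 // ltW.
have [Fn [An [HFn HAn Dn]]] : exists Fn An,
    [/\ (\int[mu n]_x (s ^+ x)%:E = Fn%:E)%E,
        (\int[mu n]_x (x%:R * s ^+ x)%:E = An%:E)%E &
        (M - 1) * An - a%:R * Fn <= 0].
  elim: n => [|n [Fn [An [HFn HAn Dn]]]]; first by exists F, A; split=> //; exact: ltW.
  exact: (drift_upper (dr n) a0 (ltW M1) suppM erefl HFn HAn Dn).
apply: (mean_le_of_pgf _ s1 HFn HAn (He n)); first by rewrite divr_ge0 // ltW.
by rewrite mulrAC ler_pdivlMr // mulrC; lra.
Qed.

Context (e_step : forall n, m * e n - a%:R <= e n.+1 <= m * e n).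

Lemma free_energy_gt0 n : a%:R < (m - 1) * e n ->
  0 < limn (fun n => e n / m ^+ n).
Proof.
move=> en; have m0 : 0 < m := lt_trans ltr01 m1.
have m10 : 0 < m - 1 by rewrite subr_gt0.
have mn0 k : 0 < m ^+ k by exact: exprn_gt0.
have e0 k : 0 <= e k by apply: nat_integral_ge0_fin (He k) => x; exact: ler0n.
pose c := a%:R / (m - 1).
have cE : (m - 1) * c = a%:R by rewrite mulrC divfK // gt_eqF.
have lower k : (e n - c) / m ^+ n <= e (n + k)%N / m ^+ (n + k)%N.
  have : (e n - c) * m ^+ k <= e (n + k)%N - c.
    elim: k => [|k IHk]; first by rewrite expr0 mulr1 addn0.
    have /andP[+ _] := e_step (n + k)%N; rewrite addnS exprSr mulrA.
    by have := ler_wpM2r (ltW m0) IHk; nra.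
  have c0 : 0 <= c by rewrite divr_ge0 // ltW.
  rewrite ler_pdivrMr // exprD mulrAC invfM mulrA mulfK ?gt_eqF //.
  rewrite ler_pdivlMr //; lra.
have noninc : nonincreasing_seq (fun k => e k / m ^+ k).
  apply/nonincreasing_seqP => k; have /andP[_ ek] := e_step k.
  by rewrite ler_pdivrMr // exprSr mulrA divfK ?gt_eqF // mulrC.
have cv : cvgn (fun k => e k / m ^+ k).
  apply: nonincreasing_is_cvgn => //; exists 0 => _ [k _ <-].
  by rewrite divr_ge0 // ltW.
apply: (@lt_le_trans _ _ ((e n - c) / m ^+ n)).
  by rewrite divr_gt0 // subr_gt0 /c ltr_pdivrMr // mulrC.
apply: limr_ge => //; near=> k.
rewrite -(@subnKC n k); first exact: lower.
by near: k; exact: nbhs_infty_ge.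
Unshelve. all: by end_near. Qed.

Lemma free_energy_eq0 (c : R) : (forall n, e n <= c) ->
  limn (fun n => e n / m ^+ n) = 0.
Proof.
move=> ec; have m0 : 0 < m := lt_trans ltr01 m1.
have e0 k : 0 <= e k by apply: nat_integral_ge0_fin (He k) => x; exact: ler0n.
apply/cvg_lim => //.
have mi : `|m^-1| < 1 by rewrite ger0_norm ?invr_ge0 ?(ltW m0) // invf_lt1.
apply: (@squeeze_cvgr _ _ _ _ (fun=> 0) (fun n => c * m^-1 ^+ n)).
- apply: nearW => n; rewrite exprVn divr_ge0 ?exprn_ge0 ?(ltW m0) //=.
  by rewrite ler_wpM2r // invr_ge0 exprn_ge0 // ltW.
- exact: cvg_cst.
- by rewrite -[X in _ --> X](mulr0 c); apply: cvgM; [exact: cvg_cst|exact: cvg_expr].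
Qed.

End Sequence.
End FreeEnergyDichotomy.

(** * The two regimes *)

Section LawsOfVariables.
Context (R : realType) (d : measure_display) (T : measurableType d).
Context (P : probability T R) (X : {RV P >-> nat}).

Lemma expectation_nat (f : nat -> R) : (forall x, 0 <= f x) ->
  ('E_P[fun w => f (X w)] = \int[distribution P X]_x (f x)%:E)%E.
Proof.
by move=> f0; rewrite unlock ge0_integral_distribution.
Qed.

Lemma meane_fin : (meane X < +oo)%E ->
  (\int[distribution P X]_x (x%:R)%:E = (mean X)%:E)%E.
Proof.
move=> Xoo; rewrite -(@expectation_nat (fun x => x%:R)) // /mean fineK //.
rewrite ge0_fin_numE // /meane (@expectation_nat (fun x => x%:R)) //.
by apply: integral_ge0 => x _; rewrite lee_fin.
Qed.

Lemma pgf_integral (s : R) : 0 <= s -> pgf_finite X s ->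
  (\int[distribution P X]_x (s ^+ x)%:E = (fine (pgf X s))%:E)%E /\
  (\int[distribution P X]_x (x%:R * s ^+ x)%:E = (s * fine (dpgf X s))%:E)%E.
Proof.
move=> s0 [Ffin F'fin]; rewrite EFinM !fineK //; split.
  by rewrite /pgf (@expectation_nat (fun x => s ^+ x)) // => x; exact: exprn_ge0.
have F0 x : 0 <= x%:R * s ^+ x.-1 by rewrite mulr_ge0 // exprn_ge0.
rewrite /dpgf (@expectation_nat (fun x => x%:R * s ^+ x.-1)) //.
rewrite -ge0_integralZl_EFin //; last by move=> x _; rewrite lee_fin.
apply: eq_integral => -[|x] _; first by rewrite !mul0r -EFinM mulr0.
by rewrite -EFinM mulrCA -exprS.
Qed.

End LawsOfVariables.

Theorem theorem1 (R : realType) (a : nat)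
    (dN : measure_display) (TN : measurableType dN) (PN : probability TN R)
    (N : {RV PN >-> nat})
    (d : nat -> measure_display) (T : forall n : nat, measurableType (d n))
    (P : forall n : nat, probability (T n) R)
    (X : forall n : nat, {RV (P n) >-> nat})
    (a_ge1 : (1 <= a)%N)
    (N_ge1 : {ae PN, forall w, (1 <= N w)%N})
    (X0_mean : (meane (X 0%N) < +oo)%E)
    (X0_nonconstant : ~ exists c : nat, {ae P 0%N, forall w, X 0%N w = c})
    (N_gt1 : (0 < PN [set w | (1 < N w)%N])%E)
    (N_mean : (meane N < +oo)%E)
    (X_DR : derrida_retaux a N X) :
  (let s := mean N `^ (a%:R)^-1 in
   pgf_finite (X 0%N) s -> 0 < D0 (X 0%N) a s (mean N) ->
   0 < free_energy N X) /\
  (forall M : R, PN [set w | (N w)%:R <= M] = 1%E ->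
   let s := 1 + (M - 1) / a%:R in
   pgf_finite (X 0%N) s -> D0 (X 0%N) a s M < 0 ->
   free_energy N X = 0).
Proof.
pose nu := distribution PN N; pose mu n := distribution (P n) (X n).
have /choice[sigma dr] : forall n, exists sigma, dr_laws a nu (mu n) sigma (mu n.+1).
  by move=> n; exact: derrida_retaux_step_laws.
have Hm : (\int[nu]_k (k%:R)%:E = (mean N)%:E)%E by exact: meane_fin.
have Hfin n : (meane (X n) < +oo)%E.
  elim: n => // n IHn; have [e' He' _] := mean_step (dr n) Hm (meane_fin IHn).
  by rewrite /meane (@expectation_nat _ _ _ _ _ (fun x => x%:R)) // He' ltry.
have He n : (\int[mu n]_x (x%:R)%:E = (mean (X n))%:E)%E by exact: meane_fin.
have e_step n : mean N * mean (X n) - a%:R <= mean (X n.+1) <= mean N * mean (X n).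
  have [e' He'] := mean_step (dr n) Hm (He n).
  by have [->] : EFin e' = EFin (mean (X n.+1)) by rewrite -He'; exact: He.
have tail2 : 0 < fine (nu [set k | (2 <= k)%N]).
  by rewrite fine_gt0 // ltey_eq fin_num_measure // andbT; exact: N_gt1.
have nu0 : nu [set 0%N] = 0%E.
  apply: (@measure_negligible _ _ _ PN (N @^-1` [set 0%N])).
    exact: (@measurable_funPTI _ _ _ _ N [set 0%N]).
  by apply: negligibleS N_ge1 => w /= ->.
have m1 : 1 < mean N.
  suff : 1 * 1 + 1 * fine (nu [set k | (2 <= k)%N]) <= mean N by lra.
  rewrite -lee_fin -Hm.
  rewrite -(nat_integral_lin_fin _ _ _ _ (nat_integral_cst nu 1) (nat_integral_tail nu 2)) //.
  apply: le_nat_integral_supp => // -[|[|k]] H; rewrite ?mulr1 ?mulr0 ?mul1r //=.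
  - by move: H; rewrite [X in X != _]nu0 eqxx.
  - by rewrite addr0.
  - by rewrite -addn2 natrD; have := ler0n R k; lra.
split=> [s fin_s D0_gt0|M NM s fin_s D0_lt0].
- have m0 : 0 < mean N by lra.
  have s0 : 0 <= s by exact: powR_ge0.
  have sa : s ^+ a = mean N.
    by rewrite -powR_mulrn // -powRrM mulVf ?powRr1 ?ltW // pnatr_eq0 -lt0n.
  have s1 : 1 < s.
    rewrite ltNge; apply/negP => s1; move: m1; rewrite -sa ltNge.
    by rewrite exprn_ile1.
  have [HF HA] := pgf_integral s0 fin_s.
  have [|n en] := supercritical_mean dr a_ge1 m1 Hm He s1 sa HF HA.
    by rewrite mulrA.
  exact: (free_energy_gt0 m1 He e_step en).
- have suppM k : nu [set k] != 0%E -> k%:R <= M.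
    apply: contraNT; rewrite -ltNge => Mk.
    pose B := [set w | (N w)%:R <= M].
    have mB : measurable B.
      exact: (@measurable_funPTI _ _ _ _ N [set k | k%:R <= M]).
    have : (PN (N @^-1` [set k]) <= PN (~` B))%E.
      apply: le_measure; rewrite ?inE.
      - exact: (@measurable_funPTI _ _ _ _ N [set k]).
      - exact: (measurableC mB).
      - by move=> w; rewrite /B /= => ->; rewrite leNgt Mk.
    rewrite probability_setC // NM subee // => nuk; rewrite eq_le nuk.
    exact: measure_ge0.
  have M1 : 1 < M.
    rewrite ltNge; apply/negP => M1; move: tail2; apply/negP; rewrite -leNgt.
    rewrite -lee_fin -nat_integral_tail -(nat_integral_cst nu 0).
    apply: le_nat_integral_supp => // k /suppM kM.
    by rewrite lern0 eqb0 -ltnNge ltnS -(ler_nat R) (le_trans kM).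
  have s0 : 0 <= s by rewrite /s addr_ge0 // divr_ge0 // subr_ge0 ltW.
  have [HF HA] := pgf_integral s0 fin_s.
  apply: (free_energy_eq0 m1 He (c := a%:R / (M - 1))).
  apply: (subcritical_mean dr a_ge1 He M1 suppM HF HA).
  by rewrite mulrA.
Qed.
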